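(* Let $c=\sum_{k\geq 0} k!\,x_1^k\in\mathbb{R}\langle\langle X\rangle\rangle$. For $n\geq 2$, Devlin's polynomials $a_n=\big((-c)^{\circ -1}\big)_n=\sum_{\eta\in X^*_n} Sa_\eta(-c)\,\eta$ satisfy $$a_n=(n-1)\sum_{\eta\in X^*_{n-1}} Sa_\eta(-c)\,\eta x_1+(n-2)\sum_{\eta\in X^*_{n-2}} Sa_\eta(-c)\,\eta x_0 .$$
   Context: Words and series. $X=\{x_0,x_1\}$ is an alphabet of two noncommuting letters, $X^*$ the set of all words over $X$ including the empty word $\emptyset$, and $\mathbb{R}\langle\langle X\rangle\rangle$ the set of formal series $c=\sum_{\eta\in X^*}\langle c,\eta\rangle\eta$ with real coefficients; $\mathbf 1=1\emptyset$. For $\eta\in X^*$, $|\eta|_{x_i}$ is the number of occurrences of $x_i$ in $\eta$, and $\deg(\eta)=2|\eta|_{x_0}+|\eta|_{x_1}+1$. $X^*_n$ is the set of words of degree $n$ (empty for $n\le 0$), and $(c)_n:=\sum_{\eta\in X^*_n}\langle c,\eta\rangle\eta$. Shuffle product. $\sqcup\!\sqcup$ is the bilinear product determined by $\emptyset\sqcup\!\sqcup\,\eta=\eta\sqcup\!\sqcup\,\emptyset=\eta$ and $x_i\eta\sqcup\!\sqcup\, x_j\nu=x_i(\eta\sqcup\!\sqcup\, x_j\nu)+x_j(x_i\eta\sqcup\!\sqcup\,\nu)$, extended to series. Feedback group. For $c,d\in\mathbb{R}\langle\langle X\rangle\rangle$ the modified composition product is $c\,\tilde\circ\,d=\sum_{\eta\in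 X^*}\langle c,\eta\rangle\,\phi_d(\eta)(\mathbf 1)$, where $\phi_d(\emptyset)=id$, $\phi_d(x_{i_1}\cdots x_{i_k})=\phi_d(x_{i_1})\circ\cdots\circ\phi_d(x_{i_k})$, $\phi_d(x_0)(e)=x_0e$, $\phi_d(x_1)(e)=x_1e+x_0(d\sqcup\!\sqcup\, e)$ for $e\in\mathbb{R}\langle\langle X\rangle\rangle$. With a formal symbol $\delta$ and $c_\delta:=\delta+c$, the set of all $c_\delta$ is a group with unit $\delta$ under $c_\delta\circ d_\delta:=\delta+d+c\,\tilde\circ\,d$. The series $c^{\circ-1}$ is defined by $c_\delta^{\circ-1}=\delta+c^{\circ-1}$. Output feedback Hopf algebra. $H$ is the free unital commutative $\mathbb{R}$-algebra (unit $\mathbf 1$) on generators $a_\eta$, $\eta\in X^*$ (coordinate functions). An element of $H$ is evaluated at a series $c$ by the unital algebra morphism with $a_\eta(c)=\langle c,\eta\rangle$. The counit satisfies $\varepsilon(a_\eta)=0$, and the coproduct $\Delta$ is the algebra morphism with $\Delta a_\eta=\tilde\Delta a_\eta+\mathbf 1\otimes a_\eta$, where $\tilde\Delta a_\eta=\sum a_{\eta(1)}\otimes a_{\eta(2)}\in H\otimes H$ is the element such that $\sum a_{\eta(1)}(c)\,a_{\eta(2)}(d)=\langle c\,\tilde\circ\,d,\eta\rangle$ for all series $c,d$. It is known that $H$ is a connected graded Hopf algebra with $\deg(a_\eta)=\deg(\eta)$; $S$ denotes its antipode, and $Sa_\eta(c)=\langle c^{\circ-1},\eta\rangle$ for every series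 $c$. The polynomials $a_n$ (indexed by integers) should not be confused with the coordinate functions $a_\eta$ (indexed by words). *)

(* Defs.v *)
From HB Require Import structures.
From mathcomp Require Import all_boot all_order all_algebra.
From mathcomp Require Import finmap monalg.
From mathcomp Require Import boolp classical_sets functions cardinality fsbigop reals.

Set Implicit Arguments.
Unset Strict Implicit.
Unset Printing Implicit Defensive.

Import Order.TTheory GRing.Theory Num.Theory.
Local Open Scope classical_set_scope.
Local Open Scope ring_scope.

Definition letter := bool.
Definition x0 : letter := false.
Definition x1 : letter := true.
Definition word := seq letter.

Definition wdeg (eta : word) : nat :=
  (2 * count_mem x0 eta + count_mem x1 eta + 1)%N.

Definition words (n : nat) : set word := [set eta | wdeg eta = n].

(* The series c is its coefficient function: c eta = <c, eta>.  Only the module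
   structure of the function space is kept, not its pointwise product. *)
Definition series (R : comNzRingType) : Type := word -> R.
HB.instance Definition _ (R : comNzRingType) :=
  GRing.Lmodule.copy (series R) (word -> R^o).

Section Series.
Variable R : comNzRingType.
Implicit Types (c d e : series R) (eta nu : word).

Definition mono eta : series R := fun nu => (nu == eta)%:R.

(* Sum of a locally finite family: for each nu, all but finitely many f i have
   coefficient 0 at nu (a finitely supported sum is 0 if the support is not
   finite). *)
Definition fsum (I : choiceType) (f : I -> series R) : series R :=
  fun nu => \sum_(i \in [set: I]) f i nu.

Definition hpart (n : nat) c : series R :=
  \sum_(eta \in words n) c eta *: mono eta.

Definition lcons (i : letter) e : series R :=
  fun nu => if nu is j :: nu' then (if j == i then e nu' else 0) else 0.

Fixpoint wshuffle (u : word) : word -> series R :=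
  fix wshuffle_u (v : word) : series R :=
    match u, v with
    | [::], _ => mono v
    | _, [::] => mono u
    | i :: u', j :: v' =>
        lcons i (wshuffle u' v) + lcons j (wshuffle_u v')
    end.

Definition shuffle c d : series R :=
  fsum (fun p : word * word => (c p.1 * d p.2) *: wshuffle p.1 p.2).

Definition phi1 d (i : letter) e : series R :=
  if i == x0 then lcons x0 e else lcons x1 e + lcons x0 (shuffle d e).

Definition phi d eta e : series R := foldr (phi1 d) e eta.

Definition mcomp c d : series R :=
  fsum (fun eta => c eta *: phi d eta (mono [::])).

(* The element delta + c of the feedback group is represented by c, so that
   the unit delta is represented by 0. *)
Definition fbmul c d : series R := d + mcomp c d.

(* The set is a singleton because the feedback group is a group, so the default
   value 0 is never used. *)
Definition fbinv c : series R :=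
  xget 0 [set d | fbmul c d = 0 /\ fbmul d c = 0].

End Series.

(* The coordinate algebra is the monoid algebra of the free commutative monoid
   on words.  Its tensor square is the monoid algebra of the product of two
   copies of this monoid: the basis element << (k, l) >> is << k >> (x) << l >>. *)
Definition tmonom : Type := ({cmonom word} * {cmonom word})%type.
HB.instance Definition _ := Choice.on tmonom.

Definition tmone : tmonom := (mone, mone).
Definition tmmul (k l : tmonom) : tmonom := (mmul k.1 l.1, mmul k.2 l.2).

Fact tmmulA : associative tmmul.
Proof. by move=> k l m; rewrite /tmmul /= !mulmA. Qed.
Fact tmmul1m : left_id tmone tmmul.
Proof. by case=> k l; rewrite /tmmul /= !mul1m. Qed.
Fact tmmulm1 : right_id tmone tmmul.
Proof. by case=> k l; rewrite /tmmul /= !mulm1. Qed.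
Fact tmmul_eq1 (k l : tmonom) : tmmul k l = tmone -> k = tmone /\ l = tmone.
Proof.
by case: k l => [k1 k2] [l1 l2] [/unitm [-> ->] /unitm [-> ->]].
Qed.
Fact tmmulC : commutative tmmul.
Proof. by move=> k l; rewrite /tmmul mulmC [mmul k.2 _]mulmC. Qed.

HB.instance Definition _ :=
  Choice_isMonomialDef.Build tmonom tmmulA tmmul1m tmmulm1 tmmul_eq1.
HB.instance Definition _ := MonomialDef_isConomialDef.Build tmonom tmmulC.

Section Hopf.
Variable R : realType.
Implicit Types (c d : series R) (eta : word).

Local Notation H := {malg R[{cmonom word}]}.
Local Notation HH := {malg R[tmonom]}.

Definition acoord eta : H := << ucm eta >>.

(* The unital algebra morphism from H to A mapping acoord eta to f eta. *)
Definition hlift (A : comAlgType R) (f : word -> A) (p : H) : A :=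
  mmap (fun a : R => a%:A)
       (fun m : {cmonom word} => \prod_(eta <- finsupp m) f eta ^+ m eta) p.

Definition heval c (p : H) : R := hlift (A := R^o) c p.

Definition counit (p : H) : R := heval 0 p.

(* For linear f and g, the map p (x) q |-> f p * g q from H (x) H to A. *)
Definition tlift (A : comAlgType R) (f g : H -> A) (p : HH) : A :=
  \sum_(k <- msupp p) p@_k *: (f << k.1 >> * g << k.2 >>).

Definition heval2 c d (p : HH) : R :=
  tlift (A := R^o) (heval c) (heval d) p.

(* The element is unique: polynomials over an infinite field are determined by
   their values. *)
Definition tcoproduct eta : HH :=
  xget 0 [set p | forall c d, heval2 c d p = mcomp c d eta].

Definition coproduct (p : H) : HH :=
  hlift (fun eta => tcoproduct eta + << (mone, ucm eta) : tmonom >>) p.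

(* S is the convolution inverse of the identity, which is unique. *)
Definition is_antipode (S : H -> H) : Prop :=
  [/\ linear S,
      forall p, tlift S id (coproduct p) = (counit p)%:A &
      forall p, tlift id S (coproduct p) = (counit p)%:A].

Definition antipode : H -> H := xget (fun=> 0) is_antipode.

End Hopf.

(* Main.v *)
Require Import Defs.
From HB Require Import structures.
From mathcomp Require Import all_boot all_order all_algebra.
From mathcomp Require Import finmap monalg.
From mathcomp Require Import boolp classical_sets functions cardinality fsbigop reals.
From mathcomp Require Import zify ring.

(** The series c is the output series of the Abel equation
    z' = u1 z^2 + s u0 z^3, z(0) = 1, for s = 0, and the output feedback
    u1 := u1 + t z u0 merely changes the parameter s into s + t.  So the
    feedback group inverse of - c is the output series of the equation for
    s = 1.  The coefficient of a word in such a series is an iterated Lie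
    derivative of z at 1, and z^m is sent by z^2 d/dz and z^3 d/dz to m z^(m+1)
    and m z^(m+2): the exponent starts at 1 and grows by the degree of each
    letter, so the coefficient is the product of the degrees of the proper
    prefixes of the word ([abel_rcons]).  This is the recursion satisfied by
    Devlin's polynomials.

    None of this requires analysis.  Every identity between series is proved by
    comparing left shifts, f |-> (eta |-> f (i :: eta)): both letters act on
    shuffles as derivations ([shuffle_cons]), and on mcomp by
    [shift_x1_mcomp] and [shift_x0_mcomp].  The right-hand sides of these rules
    involve shuffles of series that are only known to agree on short words,
    whence an induction on the length up to which two series agree
    ([eq_upto_shift]).  The output series of z^m, for all m at once, form a
    family closed under shifts and shuffles, which gives [mcomp_abel]; the same
    method gives the associativity of the feedback product and a left inverse of
    every series, hence a group.

    It remains to identify the antipode at c with the inverse of c.  Shuffle,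
    composition and inversion commute with morphisms of the coefficient ring,
    so they may be applied to the generic series whose coefficients are the
    coordinate functions themselves: this yields the coproduct and an antipode
    without ever describing them by polynomials.  Since monomials are distinct
    characters of the multiplicative monoid of series, they are linearly
    independent (Dedekind), and an element of H or of its tensor square is
    determined by its values ([heval_inj], [heval2_inj]); this turns the
    antipode axioms into the group axioms.  Finally, if S is any antipode, then
    p |-> (S p)(c) takes the translate q of p by c, q(d) = p(c * d), to p(0),
    and translation by c is invertible; so it is the evaluation at the inverse
    of c ([heval_antipode]). *)

Set Implicit Arguments.
Unset Strict Implicit.
Unset Printing Implicit Defensive.

Import Num.Theory GRing.Theory.
Local Open Scope classical_set_scope.
Local Open Scope ring_scope.

(** * Locally finite sums over words *)

Fixpoint words_upto (n : nat) : seq word :=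
  if n is m.+1 then
    [::] :: map (cons x0) (words_upto m) ++ map (cons x1) (words_upto m)
  else [:: [::]].

Lemma mem_words_upto n eta : (eta \in words_upto n) = (size eta <= n)%N.
Proof.
have inj i : injective (cons i : word -> word) by move=> u v [].
elim: n eta => [|n IHn] [|i eta] //=; rewrite inE mem_cat /=.
have memN u (s : seq word) j : j != i -> (i :: u \in map (cons j) s) = false.
  by move=> ji; apply/mapP => -[v _ [ij]]; rewrite ij eqxx in ji.
by case: i memN => memN; rewrite (mem_map (inj _)) memN // ?orbF IHn.
Qed.

Lemma words_upto_uniq n : uniq (words_upto n).
Proof.
have inj i : injective (cons i : word -> word) by move=> u v [].
elim: n => [|n IHn] //=; rewrite mem_cat cat_uniq !(map_inj_uniq (inj _)) IHn.
rewrite andbT /=; apply/andP; split.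
  by apply/norP; split; apply/mapP => -[].
by apply/hasPn => _ /mapP [u _ ->]; apply/mapP => -[].
Qed.

Lemma big_words_uptoS (V : nmodType) n (F : word -> V) :
  \sum_(eta <- words_upto n.+1) F eta =
  F [::] + (\sum_(eta <- words_upto n) F (x0 :: eta) +
            \sum_(eta <- words_upto n) F (x1 :: eta)).
Proof. by rewrite big_cons big_cat !big_map. Qed.

Lemma fsumE (R : comNzRingType) (I : choiceType) (f : I -> series R)
    (s : seq I) nu :
  uniq s -> (forall i, i \notin s -> f i nu = 0) ->
  fsum f nu = \sum_(i <- s) f i nu.
Proof.
move=> us fs; rewrite /fsum (@fsbigE _ _ _ _ _ s) //.
  by apply: eq_bigl => i; rewrite in_setT.
by move=> i _; apply: fs.
Qed.

(** * Left shifts of shuffles *)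

Section Shift.
Variable R : comNzRingType.
Implicit Types (c d e f g : series R) (i : letter) (u v nu eta : word).

Definition shift i f : series R := fun nu => f (i :: nu).

Lemma addsE f g nu : (f + g) nu = f nu + g nu. Proof. by []. Qed.
Lemma scalesE (a : R) f nu : (a *: f) nu = a * f nu. Proof. by []. Qed.
Lemma zerosE nu : (0 : series R) nu = 0. Proof. by []. Qed.
Lemma sumsE (I : Type) (s : seq I) (P : pred I) (F : I -> series R) nu :
  (\sum_(i <- s | P i) F i) nu = \sum_(i <- s | P i) F i nu.
Proof. exact: (big_morph (fun f : series R => f nu)). Qed.

Lemma wshuffle_nil u v : wshuffle R u v [::] = (nilp u && nilp v)%:R.
Proof.
case: u v => [|i u] [|j v]; rewrite ?/mono //=.
by rewrite addsE /= addr0.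
Qed.

Lemma wshuffle0r u : wshuffle R u [::] = mono R u. Proof. by case: u. Qed.
Lemma wshuffle0l u : wshuffle R [::] u = mono R u. Proof. by case: u. Qed.

(** The recursive rule of the definition, made uniform: it also covers an empty
    factor, where the shuffle is the other word. *)
Lemma wshuffle_cons u v i nu :
  wshuffle R u v (i :: nu) =
    (if u is j :: u' then (i == j)%:R * wshuffle R u' v nu else 0) +
    (if v is k :: v' then (i == k)%:R * wshuffle R u v' nu else 0).
Proof.
case: u v => [|j u] [|k v]; rewrite ?addr0 ?add0r //.
- by rewrite !wshuffle0l /mono eqseq_cons -mulnb natrM.
- by rewrite !wshuffle0r /mono eqseq_cons -mulnb natrM.
- by rewrite /= addsE /=; do 2 case: eqP => _; rewrite ?mul1r ?mul0r.
Qed.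

(** This makes the sum over pairs of words that defines the shuffle product
    locally finite. *)
Lemma wshuffle_size u v nu :
  (size nu < size u + size v)%N -> wshuffle R u v nu = 0.
Proof.
elim: nu u v => [|i nu IHnu] u v szuv.
  by rewrite wshuffle_nil; case: u v szuv => [|? ?] [].
rewrite wshuffle_cons; case: u v szuv => [|j u] [|k v] // szuv;
  rewrite ?addr0 ?add0r ?IHnu ?mulr0 ?addr0 //; move: szuv => /=; lia.
Qed.

(** The bounds on the two factors are independent: the proof of [shuffle_cons]
    shortens one factor at a time. *)
Lemma shuffleE f g n m nu : (size nu <= n)%N -> (size nu <= m)%N ->
  shuffle f g nu =
  \sum_(u <- words_upto n) \sum_(v <- words_upto m) f u * g v * wshuffle R u v nu.
Proof.
move=> len lem.
rewrite /shuffle (@fsumE _ _ _ [seq (u, v) | u <- words_upto n, v <- words_upto m]).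
- by rewrite big_allpairs.
- by rewrite allpairs_uniq ?words_upto_uniq // => -[? ?] [? ?].
move=> [u v] uv; rewrite scalesE /= wshuffle_size ?mulr0 //.
rewrite ltnNge; apply: contra uv => uv.
by apply/allpairsP; exists (u, v); rewrite !mem_words_upto /=; split=> //;
  [apply: leq_trans len|apply: leq_trans lem];
  apply: leq_trans uv; rewrite ?leq_addr ?leq_addl.
Qed.

Lemma shuffle_nil f g : shuffle f g [::] = f [::] * g [::].
Proof.
by rewrite (@shuffleE _ _ 0 0) //= !big_seq1 /mono mulr1.
Qed.

(** Left shifts are derivations for the shuffle product.  With [shuffle_nil],
    this rule characterises the product: its algebraic properties all follow
    from these two by induction on the word. *)
Lemma shuffle_cons f g i nu :
  shuffle f g (i :: nu) = shuffle (shift i f) g nu + shuffle f (shift i g) nu.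
Proof.
pose n := size nu.
have letter_sum (F : letter -> R) :
    (i == x0)%:R * F x0 + (i == x1)%:R * F x1 = F i.
  by case: i; rewrite !mul0r !mul1r ?add0r ?addr0.
rewrite (@shuffleE _ _ n.+1 n.+1) // (@shuffleE _ _ n n.+1) //.
rewrite (@shuffleE _ _ n.+1 n) //.
rewrite (eq_bigr (fun u =>
   \sum_(v <- words_upto n.+1) f u * g v *
     (if u is j :: u' then (i == j)%:R * wshuffle R u' v nu else 0)
 + \sum_(v <- words_upto n.+1) f u * g v *
     (if v is k :: v' then (i == k)%:R * wshuffle R u v' nu else 0))); last first.
  move=> u _; rewrite -big_split; apply: eq_bigr => v _.
  by rewrite wshuffle_cons mulrDr.
rewrite big_split; congr (_ + _).
  rewrite big_words_uptoS big1 ?add0r; last by move=> v _; rewrite mulr0.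
  rewrite -big_split /=; apply: eq_bigr => u _.
  rewrite -big_split /=; apply: eq_bigr => v _.
  rewrite -[shift i f u](letter_sum (fun j => f (j :: u))) /=; ring.
apply: eq_bigr => u _; rewrite big_words_uptoS mulr0 add0r.
rewrite -big_split /=; apply: eq_bigr => v _.
rewrite -[shift i g v](letter_sum (fun j => g (j :: v))) /=; ring.
Qed.

End Shift.

(** * The calculus of left shifts *)

Section Calculus.
Variable R : comNzRingType.
Implicit Types (c d e f g : series R) (i : letter) (u v nu eta : word).

Definition eq_upto (n : nat) f g := forall nu, (size nu <= n)%N -> f nu = g nu.

(** Coinduction on series: two families agree if their constant terms do and
    their shifts agree as far as the families themselves do.  The bound n does
    not grow in the hypothesis because a shift shortens the words by one. *)
Lemma eq_upto_shift (I : Type) (F G : I -> series R) :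
    (forall k, F k [::] = G k [::]) ->
    (forall n, (forall k, eq_upto n (F k) (G k)) ->
       forall i k, eq_upto n (shift i (F k)) (shift i (G k))) ->
  forall k, F k = G k.
Proof.
move=> FG0 FGS.
have FG n : forall k, eq_upto n (F k) (G k).
  elim: n => [|n IHn] k [|i nu] //= szn.
  exact: (FGS n IHn i k).
by move=> k; apply/funext => nu; apply: (FG (size nu)).
Qed.

Lemma shift_shuffle i f g :
  shift i (shuffle f g) = shuffle (shift i f) g + shuffle f (shift i g).
Proof. by apply/funext => nu; exact: shuffle_cons. Qed.

Lemma shuffleC f g : shuffle f g = shuffle g f.
Proof.
apply/funext => nu; elim: nu f g => [|i nu IHnu] f g.
  by rewrite !shuffle_nil mulrC.
by rewrite !shuffle_cons addrC IHnu [X in _ + X]IHnu.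
Qed.

Lemma shuffleDl f1 f2 g : shuffle (f1 + f2) g = shuffle f1 g + shuffle f2 g.
Proof.
apply/funext => nu; elim: nu f1 f2 g => [|i nu IHnu] f1 f2 g; rewrite addsE.
  by rewrite !shuffle_nil -mulrDl.
rewrite !shuffle_cons -[shift i (f1 + f2)]/(shift i f1 + shift i f2) !IHnu.
by rewrite !addsE addrACA.
Qed.

Lemma shuffleDr f g1 g2 : shuffle f (g1 + g2) = shuffle f g1 + shuffle f g2.
Proof. by rewrite shuffleC shuffleDl !(shuffleC f). Qed.

Lemma shuffleZl (a : R) f g : shuffle (a *: f) g = a *: shuffle f g.
Proof.
apply/funext => nu; elim: nu f g => [|i nu IHnu] f g; rewrite scalesE.
  by rewrite !shuffle_nil mulrA.
rewrite !shuffle_cons -[shift i (a *: f)]/(a *: shift i f) !IHnu.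
by rewrite !scalesE mulrDr.
Qed.

Lemma shuffleZr (a : R) f g : shuffle f (a *: g) = a *: shuffle f g.
Proof. by rewrite shuffleC shuffleZl shuffleC. Qed.

Lemma shuffle0l g : shuffle 0 g = 0.
Proof. by rewrite -[X in shuffle X](scale0r (0 : series R)) shuffleZl scale0r. Qed.

Lemma shuffle0r f : shuffle f 0 = 0.
Proof. by rewrite shuffleC shuffle0l. Qed.

Lemma shuffle_sumr (I : Type) (s : seq I) f (G : I -> series R) :
  shuffle f (\sum_(k <- s) G k) = \sum_(k <- s) shuffle f (G k).
Proof. exact: (big_morph (shuffle f) (shuffleDr f) (shuffle0r f)). Qed.

Lemma shuffleA f g e : shuffle f (shuffle g e) = shuffle (shuffle f g) e.
Proof.
apply/funext => nu; elim: nu f g e => [|i nu IHnu] f g e.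
  by rewrite !shuffle_nil mulrA.
rewrite !shuffle_cons !shift_shuffle shuffleDl shuffleDr !addsE !IHnu.
by rewrite addrA.
Qed.

(** The coefficient of a shuffle at a word depends only on the coefficients of
    the factors at words that are no longer. *)
Lemma shuffle_upto n f f' g g' :
  eq_upto n f f' -> eq_upto n g g' -> eq_upto n (shuffle f g) (shuffle f' g').
Proof.
move=> ff' gg' nu; elim: nu n f f' g g' ff' gg' => [|i nu IHnu] n f f' g g' ff' gg'.
  by rewrite !shuffle_nil ff' ?gg'.
case: n => // n in ff' gg' *; rewrite /= ltnS => szn; rewrite !shuffle_cons.
have shift_upto h h' : eq_upto n.+1 h h' -> eq_upto n (shift i h) (shift i h').
  by move=> hh' eta sze; apply: hh'.
have widen h h' : eq_upto n.+1 h h' -> eq_upto n h h'.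
  by move=> hh' eta sze; apply: hh'; apply: leqW.
by rewrite (IHnu n _ (shift i f') _ g') ?(IHnu n f f' _ (shift i g')) //;
  auto.
Qed.

Definition wmcomp d eta := phi d eta (mono R [::]).

Lemma wmcomp_cons d i eta nu :
  wmcomp d (i :: eta) nu =
  if nu is j :: nu' then
    (if i == j then wmcomp d eta nu' else 0) +
    (if (i == x1) && (j == x0) then shuffle d (wmcomp d eta) nu' else 0)
  else 0.
Proof.
rewrite /wmcomp /= /phi1; case: i => /=; case: nu => [|[] nu];
  by rewrite ?addsE /= ?addr0 ?add0r.
Qed.

(** Each letter of eta contributes a new first letter, so this series starts in
    length [size eta]; hence the sum defining mcomp is locally finite. *)
Lemma wmcomp_size d eta nu : (size nu < size eta)%N -> wmcomp d eta nu = 0.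
Proof.
elim: eta nu => [|i eta IHeta] [|j nu] // sz; rewrite wmcomp_cons //.
rewrite IHeta // [X in _ + X](_ : _ = 0) ?addr0 ?if_same //.
case: ifP => // _; rewrite -[RHS](zerosE R nu) -(shuffle0r d).
apply: (@shuffle_upto (size nu)) => // nu' sz'.
by apply: IHeta; apply: leq_ltn_trans sz' _.
Qed.

Lemma mcompE c d n nu : (size nu <= n)%N ->
  mcomp c d nu = \sum_(eta <- words_upto n) c eta * wmcomp d eta nu.
Proof.
move=> szn; apply: fsumE => [|eta]; first exact: words_upto_uniq.
rewrite mem_words_upto -ltnNge => ltn.
rewrite scalesE [phi _ _ _ _]wmcomp_size ?mulr0 //.
exact: leq_ltn_trans szn ltn.
Qed.

Lemma mcomp_nil c d : mcomp c d [::] = c [::].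
Proof. by rewrite (@mcompE _ _ 0) //= big_seq1 /wmcomp /mono mulr1. Qed.

Lemma shift_x1_mcomp c d : shift x1 (mcomp c d) = mcomp (shift x1 c) d.
Proof.
apply/funext => nu; rewrite {1}/shift.
rewrite (@mcompE _ _ (size nu).+1) // (@mcompE _ _ (size nu)) //.
rewrite big_words_uptoS big1 ?mulr0 ?add0r => [|eta _]; last first.
  by rewrite wmcomp_cons /= addr0 mulr0.
by apply: eq_bigr => eta _; rewrite wmcomp_cons /= addr0.
Qed.

(** A word of the composition that starts with x0 comes either from x0 itself or
    from the feedback term of x1.  In the latter, the shuffle with d is exchanged
    with the infinite sum over words, which may be truncated to the words of
    length at most [size nu]. *)
Lemma shift_x0_mcomp c d :
  shift x0 (mcomp c d) =
  mcomp (shift x0 c) d + shuffle d (mcomp (shift x1 c) d).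
Proof.
apply/funext => nu; rewrite {1}/shift addsE.
pose n := size nu.
rewrite (@mcompE _ _ n.+1) // (@mcompE _ _ n) //.
rewrite big_words_uptoS mulr0 add0r; congr (_ + _).
rewrite (@shuffle_upto n _ d _
   (\sum_(eta <- words_upto n) shift x1 c eta *: wmcomp d eta)) //; last first.
  by move=> nu' sz'; rewrite (mcompE _ _ sz') sumsE.
rewrite shuffle_sumr sumsE; apply: eq_bigr => eta _.
by rewrite shuffleZr scalesE wmcomp_cons /= add0r.
Qed.

Lemma mcompDl c1 c2 d : mcomp (c1 + c2) d = mcomp c1 d + mcomp c2 d.
Proof.
apply/funext => nu; rewrite addsE !(@mcompE _ _ (size nu)) // -big_split.
by apply: eq_bigr => eta _; rewrite addsE mulrDl.
Qed.

Lemma mcompZl (a : R) c d : mcomp (a *: c) d = a *: mcomp c d.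
Proof.
apply/funext => nu; rewrite scalesE !(@mcompE _ _ (size nu)) // mulr_sumr.
by apply: eq_bigr => eta _; rewrite mulrA.
Qed.

Lemma mcomp0l d : mcomp 0 d = 0.
Proof. by rewrite -[X in mcomp X](scale0r (0 : series R)) mcompZl scale0r. Qed.

Lemma mcomp0r c : mcomp c 0 = c.
Proof.
apply: (@eq_upto_shift _ (fun c => mcomp c 0) id _ _ c) => {c} [c|n IH [] c].
- exact: mcomp_nil.
- by rewrite shift_x1_mcomp; apply: IH.
- by rewrite shift_x0_mcomp shuffle0l addr0; apply: IH.
Qed.

Lemma eq_uptoD n f f' g g' :
  eq_upto n f f' -> eq_upto n g g' -> eq_upto n (f + g) (f' + g').
Proof. by move=> ff' gg' nu sz; rewrite !addsE ff' ?gg'. Qed.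

(** In analytic terms: changing the input of a product of outputs changes it in
    each factor. *)
Lemma mcomp_shuffle f g d :
  mcomp (shuffle f g) d = shuffle (mcomp f d) (mcomp g d).
Proof.
(* The family is indexed by all pairs: a shift replaces f or g by its shift. *)
apply: (@eq_upto_shift _ (fun p => mcomp (shuffle p.1 p.2) d)
   (fun p => shuffle (mcomp p.1 d) (mcomp p.2 d)) _ _ (f, g)) => {f g} [[f g]|].
  by rewrite mcomp_nil !shuffle_nil !mcomp_nil.
move=> n IH [] [f g] /=.
  rewrite shift_x1_mcomp !shift_shuffle mcompDl !shift_x1_mcomp.
  by apply: eq_uptoD; [apply: (IH (_, _))|apply: (IH (_, _))].
rewrite shift_x0_mcomp !shift_shuffle !mcompDl !shuffleDr !shift_x0_mcomp.
rewrite !(shuffleDl, shuffleDr).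
have IHd f1 g1 : eq_upto n (shuffle d (mcomp (shuffle f1 g1) d))
   (shuffle d (shuffle (mcomp f1 d) (mcomp g1 d))).
  by apply: shuffle_upto => //; apply: (IH (_, _)).
rewrite addrACA; apply: eq_uptoD; apply: eq_uptoD; first exact: (IH (_, _)).
- by rewrite -shuffleA; apply: IHd.
- exact: (IH (_, _)).
- by rewrite shuffleA (shuffleC _ d) -shuffleA; apply: IHd.
Qed.

(** Up to the reordering of summands, both sides obey the same shift rules by
    [mcomp_shuffle]. *)
Lemma mcompA c d e : mcomp (mcomp c d) e = mcomp c (fbmul d e).
Proof.
apply: (@eq_upto_shift _ (fun c => mcomp (mcomp c d) e)
   (fun c => mcomp c (fbmul d e)) _ _ c) => {c} [c|n IH [] c].
- by rewrite !mcomp_nil.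
- by rewrite !shift_x1_mcomp; apply: IH.
rewrite !shift_x0_mcomp !shift_x1_mcomp mcompDl mcomp_shuffle -addrA.
apply: eq_uptoD; first exact: IH.
rewrite addrC -shuffleDl; apply: shuffle_upto; first by [].
exact: IH.
Qed.

Lemma fbmulA c d e : fbmul c (fbmul d e) = fbmul (fbmul c d) e.
Proof. by rewrite {1 3}/fbmul -mcompA /fbmul mcompDl addrA. Qed.

Lemma fbmul0l c : fbmul 0 c = c.
Proof. by rewrite /fbmul mcomp0l addr0. Qed.

Lemma fbmul0r c : fbmul c 0 = c.
Proof. by rewrite /fbmul mcomp0r add0r. Qed.

(** The quotient of g by d, that is, the solution f of mcomp f d = g.  The shift
    rules for mcomp, solved for the shifts of f, give its coefficients by
    recursion on the word; the base series g changes along the recursion. *)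
Fixpoint mdiv d g nu {struct nu} : R :=
  match nu with
  | [::] => g [::]
  | i :: nu' =>
      mdiv d (if i then shift x1 g else shift x0 g - shuffle d (shift x1 g)) nu'
  end.

Lemma mcomp_mdiv d g : mcomp (mdiv d g) d = g.
Proof.
apply: (@eq_upto_shift _ (fun g => mcomp (mdiv d g) d) id _ _ g) => {g} [g|n IH [] g].
- by rewrite mcomp_nil.
- by rewrite shift_x1_mcomp; apply: IH.
rewrite shift_x0_mcomp -[X in eq_upto _ _ X](subrK (shuffle d (shift x1 g))).
by apply: eq_uptoD; [apply: IH|apply: shuffle_upto => //; apply: IH].
Qed.

Lemma fbmul_mdiv d : fbmul (mdiv d (- d)) d = 0.
Proof. by rewrite /fbmul mcomp_mdiv subrr. Qed.

(** In a monoid where every element has a left inverse, left inverses are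
    two-sided. *)
Lemma fbmul_eq0C c d : fbmul c d = 0 -> fbmul d c = 0.
Proof.
move=> cd0; have := fbmul_mdiv c; set c' := mdiv _ _ => c'c0.
by rewrite -[d]fbmul0l -c'c0 -(fbmulA c') cd0 fbmul0r.
Qed.

Lemma fbmul_left_inverse c d : fbmul c d = 0 -> fbinv d = c.
Proof.
move=> cd0; rewrite /fbinv; case: xgetP => [e _ [/= de0 _]|]; last first.
  by move=> /(_ c) []; split=> //; exact: fbmul_eq0C.
by rewrite -[e]fbmul0l -cd0 -fbmulA de0 fbmul0r.
Qed.

Lemma fbinvE d : fbinv d = mdiv d (- d).
Proof. exact/fbmul_left_inverse/fbmul_mdiv. Qed.

Lemma fbmulVl d : fbmul (fbinv d) d = 0.
Proof. by rewrite fbinvE fbmul_mdiv. Qed.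

Lemma fbmulVr d : fbmul d (fbinv d) = 0.
Proof. exact/fbmul_eq0C/fbmulVl. Qed.

End Calculus.

(** * Change of the coefficient ring *)

Section BaseChange.
Variables (R1 R2 : comNzRingType) (h : {rmorphism R1 -> R2}).
Implicit Types (c d f g : series R1).

Lemma map_shuffle f g : h \o shuffle f g = shuffle (h \o f) (h \o g).
Proof.
apply/funext => nu /=; elim: nu f g => [|i nu IHnu] f g.
  by rewrite !shuffle_nil rmorphM.
by rewrite !shuffle_cons rmorphD !IHnu.
Qed.

Lemma map_mcomp c d : h \o mcomp c d = mcomp (h \o c) (h \o d).
Proof.
apply: (@eq_upto_shift _ _ (fun c => h \o mcomp c d)
   (fun c => mcomp (h \o c) (h \o d)) _ _ c) => {c} [c|n IH i c].
  by rewrite mcomp_nil /= mcomp_nil.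
have shift_map f : shift i (h \o f) = h \o shift i f by [].
rewrite shift_map; case: i shift_map => _.
  by rewrite !shift_x1_mcomp; apply: IH.
rewrite !shift_x0_mcomp; have -> f g : h \o (f + g) = (h \o f) + (h \o g).
  by apply/funext => nu; apply: rmorphD.
by rewrite map_shuffle; apply: eq_uptoD; [|apply: shuffle_upto => //]; apply: IH.
Qed.

(** The image of an inverse is an inverse, and inverses are unique. *)
Lemma map_fbinv d : h \o fbinv d = fbinv (h \o d).
Proof.
apply/esym/fbmul_left_inverse; rewrite /fbmul -map_mcomp.
apply/funext => nu; rewrite addsE /= -rmorphD -addsE -/(fbmul _ _) fbmulVl.
exact: rmorph0.
Qed.

End BaseChange.

(** * Values of elements of the coordinate algebra *)

Section MonomialEvaluation.
Variables (A : comNzRingType) (f : word -> A).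
Implicit Types (m : {cmonom word}).

Definition cmeval m : A := \prod_(eta <- finsupp m) f eta ^+ m eta.

Lemma cmevalEw (D : {fset word}) m : (finsupp m `<=` D)%fset ->
  cmeval m = \prod_(eta <- D) f eta ^+ m eta.
Proof.
move=> mD; apply: big_fset_incl mD _ => eta _.
by rewrite -cmE_eq0 => /eqP ->; rewrite expr0.
Qed.

Lemma cmevalU eta : cmeval (ucm eta) = f eta.
Proof. by rewrite /cmeval mdomU big_seq_fset1 cmUU expr1. Qed.

Lemma cmeval_mmorphism : mmorphism cmeval.
Proof.
split=> [m1 m2|]; last by rewrite /cmeval mdom1 big_seq_fset0.
rewrite (@cmevalEw _ m1 (fsubsetUl _ (finsupp m2))).
rewrite (@cmevalEw _ m2 (fsubsetUr (finsupp m1) _)).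
rewrite /cmeval mdomD -big_split; apply: eq_bigr => eta _ /=.
by rewrite cmM exprD.
Qed.
HB.instance Definition _ := isMultiplicative.Build _ _ cmeval cmeval_mmorphism.

End MonomialEvaluation.

Section MonomialEvaluation2.
Variables (A : comNzRingType) (f g : word -> A).

Definition cmeval2 (k : tmonom) : A := cmeval f k.1 * cmeval g k.2.

Lemma cmeval2_mmorphism : mmorphism cmeval2.
Proof.
split=> [k l|]; last by rewrite /cmeval2 !mmorph1 mulr1.
by rewrite /cmeval2 !mmorphM mulrACA.
Qed.
HB.instance Definition _ := isMultiplicative.Build _ _ cmeval2 cmeval2_mmorphism.
End MonomialEvaluation2.

(** Dedekind's independence of characters.  Subtracting chi_0(y) times a
    relation at x from the same relation at the product y x removes the term of
    chi_0, and the other coefficients alpha_m get multiplied by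
    chi_m(y) - chi_0(y), which is nonzero for a suitable y. *)
Lemma characters_free (F : idomainType) (M : eqType) (X : Type)
    (mulX : X -> X -> X) (x1 : X) (chi : M -> X -> F) :
    (forall m x y, chi m (mulX x y) = chi m x * chi m y) ->
    (forall m, chi m x1 != 0) ->
    (forall m m', chi m =1 chi m' -> m = m') ->
  forall (s : seq M) (alpha : M -> F), uniq s ->
    (forall x, \sum_(m <- s) alpha m * chi m x = 0) ->
  forall m, m \in s -> alpha m = 0.
Proof.
move=> chiM chi1 chi_inj; elim=> [|m0 s IHs] alpha //= /andP[m0s us] sum0.
have alpha_s m : m \in s -> alpha m = 0.
  move=> ms; have /existsNP [y /eqP neq_y] : ~ (chi m =1 chi m0).
    by move=> /chi_inj eqm; rewrite -eqm ms in m0s.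
  have /eqP : alpha m * (chi m y - chi m0 y) = 0.
    apply: (IHs (fun m => alpha m * (chi m y - chi m0 y))) => // x.
    transitivity (\sum_(m' <- m0 :: s) alpha m' * chi m' (mulX y x) -
        chi m0 y * \sum_(m' <- m0 :: s) alpha m' * chi m' x); last first.
      by rewrite !sum0 mulr0 subrr.
    rewrite mulr_sumr -sumrB big_cons chiM [X in X + _](_ : _ = 0) ?add0r; last by ring.
    by apply: eq_bigr => m' _; rewrite chiM; ring.
  by rewrite mulf_eq0 subr_eq0 (negPf neq_y) orbF => /eqP.
move=> m; rewrite inE => /predU1P[->|]; last exact: alpha_s.
have := sum0 x1; rewrite big_cons big_seq big1 => [|m' /alpha_s ->]; last first.
  by rewrite mul0r.
by move/eqP; rewrite addr0 mulf_eq0 (negPf (chi1 m0)) orbF => /eqP.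
Qed.

Section CoordinateAlgebra.
Variable R : realType.
Implicit Types (c d : series R) (eta : word).

Local Notation H := {malg R[{cmonom word}]}.
Local Notation HH := {malg R[tmonom]}.
Implicit Types (p q : H) (P : HH).

HB.instance Definition _ (A : comAlgType R) (f : word -> A) :=
  GRing.RMorphism.copy (@hlift R A f) (mmap (in_alg A) (cmeval f)).
HB.instance Definition _ c :=
  GRing.RMorphism.copy (heval c) (@hlift R R^o c).

Lemma hliftU (A : comAlgType R) (f : word -> A) m : hlift f << m >> = cmeval f m.
Proof.
by rewrite -[LHS]/(mmap (in_alg A) (cmeval f) _) mmapU /= scale1r mul1r.
Qed.

Lemma hliftZ (A : comAlgType R) (f : word -> A) (a : R) p :
  hlift f (a *: p) = a *: hlift f p.
Proof. by rewrite -[LHS]/(mmap (in_alg A) (cmeval f) _) mmapZ mulr_algl. Qed.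

Lemma hlift_acoord (A : comAlgType R) (f : word -> A) eta :
  hlift f (acoord R eta) = f eta.
Proof. by rewrite hliftU cmevalU. Qed.

Lemma hevalU c m : heval c << m >> = cmeval c m.
Proof. exact: (@hliftU R^o). Qed.

Lemma hevalZ c (a : R) p : heval c (a *: p) = a * heval c p.
Proof. exact: (@hliftZ R^o). Qed.

Lemma heval_acoord c eta : heval c (acoord R eta) = c eta.
Proof. exact: (@hlift_acoord R^o). Qed.

Lemma heval2E c d : heval2 c d =1 mmap idfun (cmeval2 c d).
Proof. by move=> P; apply: eq_bigr => k _; rewrite !hevalU. Qed.

(** Two algebra morphisms on H that agree on the generators are equal; here one
    of them is factored through [hlift]. *)
Lemma heval_hlift (A : comAlgType R) (h : {rmorphism A -> R}) (f : word -> A) p :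
  (forall a : R, h a%:A = a) -> h (hlift f p) = heval (h \o f) p.
Proof.
move=> hA; rewrite /heval /hlift !mmapE rmorph_sum; apply: eq_bigr => m _.
rewrite rmorphM hA mulr_algl; congr (_ * _).
by rewrite rmorph_prod; apply: eq_bigr => eta _; rewrite rmorphXn.
Qed.

(** Evaluating at a series equal to 1 away from one word reads off the exponent
    of that word, so distinct monomials are distinct functions. *)
Lemma cmeval_pick w (a : R) m :
  cmeval (fun eta => if eta == w then a else 1) m = a ^+ m w.
Proof.
rewrite (@cmevalEw _ _ (w |` finsupp m)%fset) ?fsubsetU1 //.
rewrite (big_fsetD1 w) ?fset1U1 //= eqxx big1_fset ?mulr1 // => eta.
by rewrite !inE => /andP[/negPf -> _] _; rewrite expr1n.
Qed.

Lemma cmeval_inj m m' : (forall c, cmeval c m = cmeval c m') -> m = m'.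
Proof.
move=> eqm; apply/eqP/cmP => w.
have := eqm (fun eta => if eta == w then 2%:R else 1).
rewrite !cmeval_pick; apply: ieexprIn; first by rewrite ltr0n.
by rewrite (eqr_nat R 2 1).
Qed.

Lemma cmeval_const1 m : cmeval (fun=> 1 : R) m = 1.
Proof. by rewrite /cmeval big1 // => eta _; rewrite expr1n. Qed.

Lemma cmeval_mul c d m :
  cmeval (fun eta => c eta * d eta) m = cmeval c m * cmeval d m.
Proof. by rewrite -big_split; apply: eq_bigr => eta _; rewrite exprMn. Qed.

(** Monomials are pairwise distinct characters of the monoid of series under the
    coefficientwise product. *)
Lemma heval_inj p q : (forall c, heval c p = heval c q) -> p = q.
Proof.
move=> eqpq; apply/eqP; rewrite -subr_eq0; apply/eqP.
have {eqpq}: forall c, heval c (p - q) = 0.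
  by move=> c; rewrite rmorphB /= eqpq subrr.
move: (p - q) => {p q} p p0; apply/malgP => m; rewrite mcoeff0.
have [/mcoeff_outdom //|] := boolP (m \notin msupp p); rewrite negbK.
apply: (@characters_free R _ (series R) (fun c d eta => c eta * d eta)
  (fun=> 1) (fun m c => cmeval c m) _ _ _ (msupp p) (fun m => p@_m)).
- by move=> k c d; apply: cmeval_mul.
- by move=> k; rewrite cmeval_const1 oner_eq0.
- exact: cmeval_inj.
- exact: fset_uniq.
move=> c; rewrite -[RHS](p0 c); apply: eq_bigr => k _.
by rewrite mulr_algl.
Qed.

Lemma heval2_inj P Q : (forall c d, heval2 c d P = heval2 c d Q) -> P = Q.
Proof.
move=> eqPQ; apply/eqP; rewrite -subr_eq0; apply/eqP.
have {eqPQ}: forall c d, mmap idfun (cmeval2 c d) (P - Q) = 0.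
  by move=> c d; rewrite rmorphB /= -!heval2E eqPQ subrr.
move: (P - Q) => {P Q} P P0; apply/malgP => k; rewrite mcoeff0.
have [/mcoeff_outdom //|] := boolP (k \notin msupp P); rewrite negbK.
apply: (@characters_free R _ (series R * series R)%type
  (fun x y => (fun eta => x.1 eta * y.1 eta, fun eta => x.2 eta * y.2 eta))
  (fun=> 1, fun=> 1) (fun k x => cmeval2 x.1 x.2 k) _ _ _
  (msupp P) (fun k => P@_k)).
- by move=> l x y; rewrite /cmeval2 !cmeval_mul mulrACA.
- by move=> l; rewrite /cmeval2 !cmeval_const1 mulr1 oner_eq0.
- move=> [k1 k2] [l1 l2] eqkl; congr (_, _); apply: cmeval_inj => c.
    have := eqkl (c, fun=> 1); rewrite /cmeval2 /= !cmeval_const1 !mulr1.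
    exact.
  have := eqkl (fun=> 1, c); rewrite /cmeval2 /= !cmeval_const1 !mul1r.
  exact.
- exact: fset_uniq.
by move=> x; apply: P0.
Qed.

(** * Coproduct and antipode as composition and inversion *)

(** The element sought is the coefficient at eta of the composition of the two
    generic series over the tensor square; evaluation is a ring morphism, which
    commutes with composition. *)
Lemma heval2_tcoproduct c d eta : heval2 c d (tcoproduct R eta) = mcomp c d eta.
Proof.
rewrite /tcoproduct; case: xgetP => [P _ ->//|].
pose X1 eta : HH := << ((ucm eta, mone) : tmonom) >>.
pose X2 eta : HH := << ((mone, ucm eta) : tmonom) >>.
move=> /(_ (mcomp X1 X2 eta)) [] {}c {}d.
rewrite heval2E -[LHS]/((mmap idfun (cmeval2 c d) \o mcomp X1 X2) eta) map_mcomp.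
congr (mcomp _ _ eta); apply/funext => nu /=;
  by rewrite mmapU /= mul1r /cmeval2 /= cmevalU mmorph1 ?mulr1 ?mul1r.
Qed.

Lemma heval2_coproduct c d p :
  heval2 c d (coproduct p) = heval (fbmul c d) p.
Proof.
rewrite heval2E heval_hlift => [|a]; last by rewrite /= mmapZ mmap1 mulr1.
congr (heval _ p); apply/funext => eta /=.
rewrite rmorphD /= -heval2E heval2_tcoproduct addrC; congr (_ + _).
by rewrite mmapU /= mul1r /cmeval2 /= cmevalU mmorph1 mul1r.
Qed.

Lemma heval_tlift c (f g : H -> H) P :
  heval c (tlift f g P) =
  \sum_(k <- msupp P) P@_k * (heval c (f << k.1 >>) * heval c (g << k.2 >>)).
Proof.
by rewrite rmorph_sum /=; apply: eq_bigr => k _; rewrite hevalZ rmorphM.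
Qed.

Lemma heval_alg c (a : R) : heval c a%:A = a.
Proof. by rewrite hevalZ rmorph1 mulr1. Qed.

(** The coefficients of the inverse of the generic series are the polynomial
    expressions of the coefficients of an inverse. *)
Lemma heval_fbinv c p :
  heval c (hlift (fbinv (@acoord R)) p) = heval (fbinv c) p.
Proof.
rewrite heval_hlift => [|a]; last exact: heval_alg.
rewrite map_fbinv; congr (heval (fbinv _) p); apply/funext => eta.
exact: heval_acoord.
Qed.

(** After evaluation at c, the two antipode axioms say that the inverse of c is a
    left and a right inverse. *)
Lemma antipode_exists : is_antipode (hlift (fbinv (@acoord R))).
Proof.
split=> [a p q|p|p].
- by rewrite rmorphD /= hliftZ.
- apply: heval_inj => c; rewrite heval_alg heval_tlift.
  rewrite /counit -(fbmulVl c) -heval2_coproduct; apply: eq_bigr => k _.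
  by rewrite heval_fbinv.
- apply: heval_inj => c; rewrite heval_alg heval_tlift.
  rewrite /counit -(fbmulVr c) -heval2_coproduct; apply: eq_bigr => k _.
  by rewrite heval_fbinv.
Qed.

(** The element whose value at d is that of p at the product of c and d; the
    coproduct makes it again an element of H. *)
Definition translate c p : H :=
  \sum_(k <- msupp (coproduct p)) ((coproduct p)@_k * cmeval c k.1) *: << k.2 >>.

Lemma heval_translate c d p : heval d (translate c p) = heval (fbmul c d) p.
Proof.
rewrite -heval2_coproduct rmorph_sum /=; apply: eq_bigr => k _.
by rewrite hevalZ !hevalU -mulrA.
Qed.

Lemma translateK c p : translate c (translate (fbinv c) p) = p.
Proof.
by apply: heval_inj => d; rewrite !heval_translate fbmulA fbmulVl fbmul0l.
Qed.

(** For an antipode S, the right antipode axiom evaluated at c says that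
    p |-> (S p)(c) maps the translate of q by c to q(0).  Taking for q the
    translate of p by the inverse of c, whose value at 0 is the value of p at
    that inverse, gives the result. *)
Lemma heval_antipode c p : heval c (antipode p) = heval (fbinv c) p.
Proof.
have : is_antipode (@antipode R).
  by rewrite /antipode; case: xgetP => // /(_ _ antipode_exists).
move: (@antipode R) => S [linS _ idS].
pose L : {linear H -> H} := HB.pack S (GRing.isLinear.Build _ _ _ _ _ linS).
have SZ (a : R) q : S (a *: q) = a *: S q by exact: (linearZZ L).
have S_translate q : heval c (S (translate c q)) = heval 0 q.
  rewrite -[RHS](heval_alg c) -idS heval_tlift -[S]/(L : H -> H) linear_sum.
  rewrite rmorph_sum /=; apply: eq_bigr => k _.
  by rewrite SZ hevalZ hevalU mulrA.
by rewrite -{1}(translateK c p) S_translate heval_translate fbmul0r.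
Qed.

End CoordinateAlgebra.

(** * Output series of the Abel equation *)

Lemma wdeg_cons i nu : wdeg (i :: nu) = (wdeg nu + (if i then 1 else 2))%N.
Proof.
by rewrite /wdeg /=; case: i => /=; move: (count _ nu) (count _ nu) => a b; lia.
Qed.

Lemma wdeg_rcons nu i : wdeg (rcons nu i) = (wdeg nu + (if i then 1 else 2))%N.
Proof.
by elim: nu => [|j nu IHnu]; rewrite ?rcons_cons !wdeg_cons // IHnu addnAC.
Qed.

Lemma size_wdeg nu : (size nu < wdeg nu)%N.
Proof.
elim: nu => [//|i nu IHnu]; rewrite wdeg_cons; apply: leq_ltn_trans IHnu _.
by rewrite -[X in (X < _)%N]addn0 ltn_add2l; case: i.
Qed.

Section AbelSeries.
Variable R : comNzRingType.
Implicit Types (s t : R) (m n : nat) (nu : word).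

(** The output series of z^m for z' = u1 z^2 + s u0 z^3, z(0) = 1: the letter x1
    acts on z^m as z^2 d/dz and x0 as s z^3 d/dz, and z^m has value 1 at the
    initial point. *)
Fixpoint abel s m nu {struct nu} : R :=
  match nu with
  | [::] => 1
  | i :: nu' => if i then m%:R * abel s m.+1 nu' else s * m%:R * abel s m.+2 nu'
  end.

Lemma shift_x1_abel s m : shift x1 (abel s m) = m%:R *: (abel s m.+1 : series R).
Proof. by []. Qed.

Lemma shift_x0_abel s m :
  shift x0 (abel s m) = (s * m%:R) *: (abel s m.+2 : series R).
Proof. by []. Qed.

(** The output series of a product of outputs is the shuffle of their series,
    and z^m z^n = z^(m+n). *)
Lemma shuffle_abel s m n : shuffle (abel s m) (abel s n) = abel s (m + n).
Proof.
apply/funext => nu; elim: nu m n => [|i nu IHnu] m n.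
  by rewrite shuffle_nil mulr1.
rewrite shuffle_cons; case: i.
  rewrite !shift_x1_abel shuffleZl shuffleZr !scalesE !IHnu addSn addnS /=.
  by rewrite natrD mulrDl.
rewrite !shift_x0_abel shuffleZl shuffleZr !scalesE !IHnu !addSn !addnS /=.
by rewrite natrD mulrDr mulrDl.
Qed.

(** Replacing u1 by u1 + t z u0 in the equation adds t z^3 u0 to its right-hand
    side. *)
Lemma mcomp_abel s t m :
  mcomp (abel s m) (t *: (abel (s + t) 1 : series R)) = abel (s + t) m.
Proof.
set d := t *: _.
apply: (@eq_upto_shift _ _ (fun m => mcomp (abel s m) d)
  (fun m => abel (s + t) m) _ _ m) => {m} [m|n IH i m]; first exact: mcomp_nil.
have IHZ (a : R) k : eq_upto n (mcomp (a *: (abel s k : series R)) d)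
                         (a *: (abel (s + t) k : series R)).
  by move=> nu sz; rewrite mcompZl !scalesE IH.
case: i; first by rewrite shift_x1_mcomp !shift_x1_abel; apply: IHZ.
rewrite shift_x0_mcomp shift_x1_abel !shift_x0_abel.
have -> : ((s + t) * m%:R) *: (abel (s + t) m.+2 : series R) =
    (s * m%:R) *: (abel (s + t) m.+2 : series R) +
    shuffle d (m%:R *: (abel (s + t) m.+1 : series R)).
  by rewrite /d shuffleZl shuffleZr shuffle_abel scalerA -scalerDl -mulrDl.
by apply: eq_uptoD; [|apply: shuffle_upto => //]; apply: IHZ.
Qed.

(** The last letter of the word acts last, on the power of z reached from z^m
    through nu, whose exponent is m plus the degrees of the letters of nu, that
    is, m plus the degree of nu minus one. *)
Lemma abel_rcons s m nu i :
  abel s m (rcons nu i) =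
  (if i then 1 else s) * (m + (wdeg nu).-1)%:R * abel s m nu.
Proof.
elim: nu m => [|j nu IHnu] m.
  by rewrite addn0; case: i; rewrite /= !mulr1 ?mul1r.
have degS : (m + (wdeg (j :: nu)).-1 = m + (if j then 1 else 2) + (wdeg nu).-1)%N.
  by rewrite wdeg_cons; move: (wdeg nu) (size_wdeg nu) => [//|d] _; lia.
by rewrite degS /= !IHnu; case: j {degS}; rewrite ?addn1 ?addn2 mulrCA.
Qed.

(** For s = 0 only the powers of x1 survive, with rising factorials of m+1 as
    coefficients; multiplying by m! makes them factorials. *)
Lemma abel0E m nu :
  m`!%:R * abel 0 m.+1 nu = (nu == nseq (size nu) x1)%:R * (m + size nu)`!%:R.
Proof.
elim: nu m => [|i nu IHnu] m /=; first by rewrite addn0 mulr1 mul1r.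
case: i => /=; last by rewrite !(mul0r, mulr0).
by rewrite mulrA -natrM mulnC -factS IHnu addnS.
Qed.

Lemma factorial_seriesE :
  fsum (fun k : nat => k`!%:R *: mono R (nseq k x1)) = abel 0 1.
Proof.
apply/funext => nu; rewrite (@fsumE _ _ _ [:: size nu]) // => [|k].
  by rewrite big_seq1 scalesE -[RHS]mul1r (abel0E 0) add0n mulrC.
move=> ksz; rewrite scalesE /mono (_ : (nu == _) = false) ?mulr0 //.
by apply: contraNF ksz => /eqP ->; rewrite size_nseq inE.
Qed.

(** The feedback u1 := u1 - z u0 turns the equation for s = 1 into that for
    s = 0. *)
Lemma fbinv_factorial_series : fbinv (- (abel 0 1 : series R)) = abel 1 1.
Proof.
apply: fbmul_left_inverse; rewrite /fbmul.
have -> : - (abel 0 1 : series R) = (-1) *: (abel (1 + -1) 1 : series R).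
  by rewrite subrr scaleN1r.
by rewrite mcomp_abel scaleN1r addNr.
Qed.

Lemma big_wordsE n (f : word -> R) (h : word -> word) nu :
  (\sum_(eta \in words n) f eta *: mono R (h eta)) nu =
  \sum_(eta <- words_upto n | wdeg eta == n) f eta * (nu == h eta)%:R.
Proof.
rewrite (@fsbigE _ _ _ _ _ [seq eta <- words_upto n | wdeg eta == n]).
- rewrite sumsE big_filter_cond; apply: eq_bigl => eta.
  by apply: andb_idr => /eqP wn; rewrite in_setE.
- by rewrite filter_uniq ?words_upto_uniq.
- by move=> eta /=; rewrite mem_filter => /andP[/eqP].
move=> eta /= wn; rewrite mem_filter mem_words_upto wn eqxx /= => /negP [].
by rewrite -wn ltnW ?size_wdeg.
Qed.

Lemma big_words_image n (f : word -> R) (h : word -> word) eta : injective h ->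
  (\sum_(nu \in words n) f nu *: mono R (h nu)) (h eta) =
  (wdeg eta == n)%:R * f eta.
Proof.
move=> inj; rewrite big_wordsE; have [wn|wn] := eqVneq (wdeg eta) n.
  rewrite big_mkcond (bigD1_seq eta) ?words_upto_uniq //=; last first.
    by rewrite mem_words_upto -wn ltnW ?size_wdeg.
  rewrite wn !eqxx big1 ?addr0 ?mulr1 ?mul1r // => nu /negPf neq.
  by rewrite (inj_eq inj) [eta == _]eq_sym neq mulr0 if_same.
rewrite mul0r big1 // => nu /eqP wnu; rewrite (inj_eq inj).
by case: eqP => [enu|]; rewrite ?mulr0 // -wnu enu eqxx in wn *.
Qed.

Lemma big_words_notin n (f : word -> R) (h : word -> word) nu :
  (forall eta, nu != h eta) ->
  (\sum_(eta \in words n) f eta *: mono R (h eta)) nu = 0.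
Proof.
by move=> nuh; rewrite big_wordsE big1 // => eta _; rewrite (negPf (nuh eta)) mulr0.
Qed.

End AbelSeries.

Theorem corollary12 (R : realType) (n : nat) (hn : (2 <= n)%N) :
  let c : series R := fsum (fun k : nat => k`!%:R *: mono R (nseq k x1)) in
  let a : series R := hpart n (fbinv (- c)) in
  a = \sum_(eta \in words n)
        heval (- c) (antipode (acoord R eta)) *: mono R eta
  /\
  a = (n - 1)%N%:R *: (\sum_(eta \in words (n - 1)%N)
        heval (- c) (antipode (acoord R eta)) *: mono R (rcons eta x1))
    + (n - 2)%N%:R *: (\sum_(eta \in words (n - 2)%N)
        heval (- c) (antipode (acoord R eta)) *: mono R (rcons eta x0)).
Proof.
move=> c a.
have antipodeE eta : heval (- c) (antipode (acoord R eta)) = fbinv (- c) eta.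
  by rewrite heval_antipode heval_acoord.
have abelE : fbinv (- c) = abel (1 : R) 1.
  by rewrite /c factorial_seriesE fbinv_factorial_series.
split; first by apply: eq_fsbigr => eta _; rewrite antipodeE.
under [in X in _ *: X + _]eq_fsbigr do rewrite antipodeE.
under [in X in _ + _ *: X]eq_fsbigr do rewrite antipodeE.
rewrite /a /hpart abelE; apply/funext => nu; rewrite addsE !scalesE.
have rcons_inj i : injective (rcons^~ i : word -> word).
  by move=> u v /rcons_inj [].
(* The empty word has degree 1 < n. *)
case/lastP: nu => [|nu i].
  rewrite (@big_words_image _ n _ id [::]) // (ltn_eqF hn) mul0r.
  by rewrite !big_words_notin ?mulr0 ?addr0 // => eta; case: eta.
rewrite (@big_words_image _ n _ id) // abel_rcons add1n.
have notin j : j != i -> forall eta, rcons nu i != rcons eta j.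
  by move=> ji eta; rewrite eqseq_rcons (eq_sym i) (negPf ji) andbF.
(* Both sides vanish unless nu has degree n - k; since k <= 2 <= n, the
   subtraction is not truncated. *)
have coefE k (x : R) : (k <= 2)%N ->
    (wdeg nu + k == n)%N%:R * ((wdeg nu)%:R * x) =
    (n - k)%N%:R * ((wdeg nu == (n - k)%N)%:R * x).
  move=> k2; rewrite -(eqn_add2r k _ (n - k)) subnK ?(leq_trans k2) //.
  by case: eqVneq => [<-|]; rewrite ?mul0r ?mulr0 // !mul1r addnK.
rewrite prednK ?(leq_ltn_trans _ (size_wdeg nu)) // if_same mul1r wdeg_rcons.
case: i notin => notin; rewrite coefE //.
  rewrite [X in _ + _ * X]big_words_notin ?mulr0 ?addr0; last exact: notin.
  by rewrite (@big_words_image _ _ _ (rcons^~ x1)).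
rewrite [X in _ * X + _]big_words_notin ?mulr0 ?add0r; last exact: notin.
by rewrite (@big_words_image _ _ _ (rcons^~ x0)).
Qed.
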